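(* With general cardinal utilities (i.e. arbitrary utilities $u_{ij}\in\mathbb{R}_{\ge 0}$), no mechanism for online fair division (even one that is not non-wasteful) is both envy-free ex ante and Pareto efficient ex ante.
   Context: Setting. An online fair division instance consists of a set of agents $N=\{1,\ldots,n\}$, an ordered set of indivisible items $O=\{o_1,\ldots,o_m\}$, and sincere utilities $u_{ij}\in\mathbb{R}_{\ge 0}$ of each agent $i\in N$ for each item $o_j$. It is supposed that at least one agent has positive utility for every item (otherwise the item can simply be discarded). Item $o_j$ arrives at round $j$, and each agent $i$ places a bid $v_{ij}\in\mathbb{R}_{\ge 0}$ for it; agents are supposed to bid sincerely, i.e. $v_{ij}=u_{ij}$. An (online) mechanism is defined on all instances (all numbers of agents and items) and allocates $o_j$ immediately and irrevocably (possibly with randomization), with the allocation of $o_1,\ldots,o_{j-1}$ fixed and with no information about $o_{j+1},\ldots,o_m$; thus its behaviour on $o_1,\ldots,o_j$ depends only on the bids for $o_1,\ldots,o_j$. An allocation $\pi_j$ of $o_1,\ldots,o_j$ gives a bundle $\pi_{ji}$ to each agent $i$, with the bundles pairwise disjoint and with union $\{o_1,\ldots,o_j\}$; $\Pi_j$ is the set of all such allocations, and a mechanism induces a probability distribution over $\Pi_j$. A mechanism is non-wasteful if it shares the probability of 1 for each $o_j$ only among agents that bid positively for it if there is at least one such agent and, otherwise, discards $o_j$. Write $p_{ih}(\Pi_j)$ for the probability that agent $i$ receives item $o_h$ in this distribution, $\overline{u}_{ik}(\Pi_j)=\sum_{h=1}^{j}p_{kh}(\Pi_j)\,u_{ih}$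 for the expected utility of agent $i$ for the expected allocation of agent $k$, and $\overline{u}_i=\overline{u}_{ii}$. Envy-free ex ante: for each instance with $m\in\mathbb{N}$ items, $\overline{u}_{ii}(\Pi_m)\ge\overline{u}_{ik}(\Pi_m)$ for all $i,k\in N$. Pareto efficient ex ante: for each instance with $m\in\mathbb{N}$ items, no mechanism gives expected utility at least $\overline{u}_i(\Pi_m)$ to each $i\in N$ and more than $\overline{u}_k(\Pi_m)$ to some $k\in N$. *)

(* Defs.v *)
From HB Require Import structures.
From mathcomp Require Import all_boot all_order all_algebra.
From mathcomp Require Import reals.

Set Implicit Arguments.
Unset Strict Implicit.
Unset Printing Implicit Defensive.

Import Order.TTheory GRing.Theory Num.Theory.

Local Open Scope ring_scope.

(* [u i h] is the utility of agent [i] for the [h]-th arriving item.  Bidding is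
   sincere, so the same matrix is the matrix of bids.  The second condition
   forces [0 < n] as soon as there is an item. *)
Definition is_instance (R : realType) (n m : nat) (u : 'M[R]_(n, m)) : Prop :=
  (forall i h, 0 <= u i h) /\ (forall h, exists i, 0 < u i h).

(* An allocation of [m] items gives each item to exactly one agent; the bundle
   of agent [i] in [a] is [[set h | a h == i]]. *)
Notation allocation n m := {ffun 'I_m -> 'I_n}.

(* Items are numbered from 0: [rule v a i] is the probability that item [j] goes
   to agent [i], given the bids [v] for items 0, ..., j and the allocation [a] of
   items 0, ..., j - 1 already made.  Agents with zero bid may receive items. *)
Record mechanism (R : realType) := Mechanism {
  rule : forall n j : nat, 'M[R]_(n, j.+1) -> allocation n j -> 'I_n -> R;
  rule_ge0 : forall n j (v : 'M[R]_(n, j.+1)) (a : allocation n j) (i : 'I_n),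
    is_instance v -> 0 <= rule v a i;
  rule_sum1 : forall n j (v : 'M[R]_(n, j.+1)) (a : allocation n j),
    is_instance v -> \sum_(i < n) rule v a i = 1
}.

(* Bids for items 0, ..., j (inclusive). *)
Definition bids_upto (R : realType) (n m : nat) (u : 'M[R]_(n, m)) (j : 'I_m) :
    'M[R]_(n, j.+1) :=
  \matrix_(i < n, h < j.+1) u i (widen_ord (ltn_ord j) h).

(* Allocation of items 0, ..., j - 1 (exclusive). *)
Definition alloc_before (n m : nat) (a : allocation n m) (j : 'I_m) :
    allocation n j :=
  [ffun h : 'I_j => a (widen_ord (ltnW (ltn_ord j)) h)].

(* Chain rule: the probability that the mechanism ends with allocation [a]. *)
Definition alloc_prob (R : realType) (M : mechanism R) (n m : nat)
    (u : 'M[R]_(n, m)) (a : allocation n m) : R :=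
  \prod_(j < m) rule M (bids_upto u j) (alloc_before a j) (a j).

Definition item_prob (R : realType) (M : mechanism R) (n m : nat)
    (u : 'M[R]_(n, m)) (i : 'I_n) (h : 'I_m) : R :=
  \sum_(a : allocation n m | a h == i) alloc_prob M u a.

(* Expected utility of agent [i] for the expected allocation of agent [k]. *)
Definition exp_util (R : realType) (M : mechanism R) (n m : nat)
    (u : 'M[R]_(n, m)) (i k : 'I_n) : R :=
  \sum_(h < m) item_prob M u k h * u i h.

Definition envy_free_ex_ante (R : realType) (M : mechanism R) : Prop :=
  forall (n m : nat) (u : 'M[R]_(n, m)), is_instance u ->
  forall i k : 'I_n, exp_util M u i k <= exp_util M u i i.

Definition pareto_efficient_ex_ante (R : realType) (M : mechanism R) : Prop :=
  forall (n m : nat) (u : 'M[R]_(n, m)), is_instance u ->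
  ~ exists M' : mechanism R,
      (forall i : 'I_n, exp_util M u i i <= exp_util M' u i i) /\
      (exists k : 'I_n, exp_util M u k k < exp_util M' u k k).

(* Main.v *)
(** Take two agents and two items, agent [i] having utility 2 for item [i] and
    1 for the other item.  Envy-freeness after the first item forces that item
    to be split evenly; since this choice is irrevocable, envy-freeness after
    the second item forces an even split of the second item too, so both agents
    expect 3/2.  Giving item [i] to agent [i] yields 2 to both. *)
Require Import Defs.
From HB Require Import structures.
From mathcomp Require Import all_boot all_order all_algebra.
From mathcomp Require Import reals.
From mathcomp Require Import lra.

Set Implicit Arguments.
Unset Strict Implicit.
Unset Printing Implicit Defensive.

Import Order.TTheory GRing.Theory Num.Theory.

Local Open Scope ring_scope.

Definition init_bids (R : realType) (n m : nat) (u : 'M[R]_(n, m.+1)) :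
    'M[R]_(n, m) := colsub (widen_ord (leqnSn m)) u.

Definition alloc_init (n m : nat) (a : allocation n m.+1) : allocation n m :=
  alloc_before a ord_max.

(** With [alloc_init], this makes allocations of [m.+1] items correspond to pairs of an allocation
    of [m] items and an owner of the last one; sums over allocations are reindexed along it. *)
Definition alloc_rcons (n m : nat) (b : allocation n m) (x : 'I_n) :
    allocation n m.+1 :=
  [ffun h => if unlift ord_max h is Some h' then b h' else x].

Lemma widen_ord_lift_max (m : nat) (le_m : (m <= m.+1)%N) (h : 'I_m) :
  widen_ord le_m h = lift ord_max h.
Proof. by apply: val_inj; rewrite /= /bump leqNgt ltn_ord. Qed.

Lemma alloc_rcons_widen (n m : nat) (b : allocation n m) (x : 'I_n)
    (le_m : (m <= m.+1)%N) (h : 'I_m) :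
  alloc_rcons b x (widen_ord le_m h) = b h.
Proof. by rewrite ffunE widen_ord_lift_max liftK. Qed.

Lemma alloc_rcons_max (n m : nat) (b : allocation n m) (x : 'I_n) :
  alloc_rcons b x ord_max = x.
Proof. by rewrite ffunE unlift_none. Qed.

Lemma alloc_rconsK (n m : nat) (b : allocation n m) (x : 'I_n) :
  alloc_init (alloc_rcons b x) = b.
Proof. by apply/ffunP => h; rewrite ffunE alloc_rcons_widen. Qed.

Lemma alloc_initK (n m : nat) (a : allocation n m.+1) :
  alloc_rcons (alloc_init a) (a ord_max) = a.
Proof.
apply/ffunP => h; rewrite ffunE; case: unliftP => [h' ->|-> //].
by rewrite ffunE widen_ord_lift_max.
Qed.

Lemma is_instance_init (R : realType) (n m : nat) (u : 'M[R]_(n, m.+1)) :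
  is_instance u -> is_instance (init_bids u).
Proof.
move=> [u_ge0 u_gt0]; split=> [i h|h]; first by rewrite mxE.
by have [i ui] := u_gt0 (widen_ord (leqnSn m) h); exists i; rewrite mxE.
Qed.

Lemma is_instance_bids_upto (R : realType) (n m : nat) (u : 'M[R]_(n, m))
    (j : 'I_m) : is_instance u -> is_instance (bids_upto u j).
Proof.
move=> [u_ge0 u_gt0]; split=> [i h|h]; first by rewrite mxE.
by have [i ui] := u_gt0 (widen_ord (ltn_ord j) h); exists i; rewrite mxE.
Qed.

Lemma alloc_prob_recr (R : realType) (M : mechanism R) (n m : nat)
    (u : 'M[R]_(n, m.+1)) (a : allocation n m.+1) :
  alloc_prob M u a =
  alloc_prob M (init_bids u) (alloc_init a) *
  rule M (bids_upto u ord_max) (alloc_init a) (a ord_max).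
Proof.
rewrite /alloc_prob big_ord_recr /=; congr (_ * _); apply: eq_bigr => j _.
(* Truncating before or after dropping the last item differs only in the bound proofs inside
   ordinals. *)
have -> : bids_upto (init_bids u) j =
    bids_upto u (widen_ord (leqnSn m) j) :> 'M_(n, j.+1).
  by apply/matrixP => i h; rewrite !mxE; congr (u _ _); apply: val_inj.
have -> : alloc_before (alloc_init a) j =
    alloc_before a (widen_ord (leqnSn m) j) :> allocation n j.
  by apply/ffunP => h; rewrite !ffunE; congr (a _); apply: val_inj.
by rewrite ffunE; congr (rule _ _ _ (a _)); apply: val_inj.
Qed.

(** The event [P] ignores the last item, whose rule probabilities sum to 1 for each fixed earlier
    allocation, so that item is summed out. A general [P] serves both the total mass and the share
    of a single item. *)
Lemma sum_alloc_prob_init (R : realType) (M : mechanism R) (n m : nat)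
    (u : 'M[R]_(n, m.+1)) (P : pred (allocation n m)) : is_instance u ->
  \sum_(a | P (alloc_init a)) alloc_prob M u a =
  \sum_(b | P b) alloc_prob M (init_bids u) b.
Proof.
move=> u_inst.
rewrite (reindex (fun p : allocation n m * 'I_n => alloc_rcons p.1 p.2)) /=;
  last first.
  exists (fun a => (alloc_init a, a ord_max)) => [[b x] _|a _] /=.
    by rewrite alloc_rconsK alloc_rcons_max.
  exact: alloc_initK.
(* The trivial conjunct gives the filter the product form that [pair_big] expects. *)
rewrite (eq_bigl (fun p => P p.1 && true)); last first.
  by move=> [b x] /=; rewrite alloc_rconsK andbT.
rewrite -(pair_big P xpredT (fun b x => alloc_prob M u (alloc_rcons b x))) /=.
apply: eq_bigr => b _.
under eq_bigr => x _ do
  rewrite alloc_prob_recr alloc_rconsK alloc_rcons_max.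
rewrite -big_distrr /= rule_sum1 ?mulr1 //.
exact: (is_instance_bids_upto ord_max u_inst).
Qed.

Lemma sum_alloc_prob (R : realType) (M : mechanism R) (n m : nat)
    (u : 'M[R]_(n, m)) : is_instance u ->
  \sum_(a : allocation n m) alloc_prob M u a = 1.
Proof.
elim: m u => [|m IHm] u u_inst.
  rewrite (eq_bigr (fun=> 1)) => [|a _]; last by rewrite /alloc_prob big_ord0.
  by rewrite sumr_const card_ffun !card_ord expn0.
rewrite (sum_alloc_prob_init M xpredT u_inst).
exact/IHm/is_instance_init.
Qed.

(** Irrevocability: a later arrival cannot change earlier shares. Constraints from a shorter
    instance thus carry over to its extension. *)
Lemma item_prob_init (R : realType) (M : mechanism R) (n m : nat)
    (u : 'M[R]_(n, m.+1)) (i : 'I_n) (h : 'I_m) : is_instance u ->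
  item_prob M u i (widen_ord (leqnSn m) h) = item_prob M (init_bids u) i h.
Proof.
move=> u_inst; rewrite /item_prob.
rewrite -(sum_alloc_prob_init M (fun b => b h == i) u_inst).
apply: eq_bigl => a; rewrite ffunE; congr (a _ == i); exact: val_inj.
Qed.

Lemma sum_item_prob (R : realType) (M : mechanism R) (n m : nat)
    (u : 'M[R]_(n, m)) (h : 'I_m) : is_instance u ->
  \sum_(i < n) item_prob M u i h = 1.
Proof.
move=> u_inst; rewrite -(sum_alloc_prob M u_inst).
by rewrite (partition_big (fun a : allocation n m => a h) xpredT).
Qed.

(** The dominating mechanism must be defined on all instances. Taking turns is, and with two agents
    and two items it gives item [i] to agent [i]. *)
Definition round_robin_rule (R : realType) (n j : nat) (v : 'M[R]_(n, j.+1))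
    (a : allocation n j) (i : 'I_n) : R := (val i == j %% n)%N%:R.

Lemma round_robin_rule_ge0 (R : realType) (n j : nat) (v : 'M[R]_(n, j.+1))
    (a : allocation n j) (i : 'I_n) :
  is_instance v -> 0 <= round_robin_rule v a i.
Proof. by rewrite ler0n. Qed.

Lemma round_robin_rule_sum1 (R : realType) (n j : nat) (v : 'M[R]_(n, j.+1))
    (a : allocation n j) :
  is_instance v -> \sum_(i < n) round_robin_rule v a i = 1.
Proof.
(* Some agent values item 0, so [n] is positive and the residue modulo [n] names an agent. *)
move=> [_ /(_ ord0) [i0 _]].
have n_gt0 : (0 < n)%N := leq_ltn_trans (leq0n i0) (ltn_ord i0).
rewrite (bigD1 (Ordinal (ltn_pmod j n_gt0))) //= /round_robin_rule eqxx.
by rewrite big1 ?addr0 // => i /negPf; rewrite -val_eqE /= => ->.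
Qed.

Definition round_robin (R : realType) : mechanism R :=
  Mechanism (@round_robin_rule_ge0 R) (@round_robin_rule_sum1 R).

Lemma item_prob_round_robin (R : realType) (n m : nat) (u : 'M[R]_(n, m))
    (i : 'I_n) (h : 'I_m) : is_instance u ->
  item_prob (round_robin R) u i h = (val i == h %% n)%N%:R.
Proof.
move=> u_inst; have n_gt0 : (0 < n)%N := leq_ltn_trans (leq0n i) (ltn_ord i).
(* An allocation giving [h] out of turn has a zero factor; the agent whose turn it is then gets the
   whole mass 1. *)
have off (k : 'I_n) : (val k != h %% n)%N -> item_prob (round_robin R) u k h = 0.
  move=> k_neq; apply: big1 => a /eqP ah.
  by rewrite /alloc_prob (bigD1 h) //= /round_robin_rule ah (negPf k_neq) mul0r.
have [i_eq|/off //] := eqVneq (val i) (h %% n)%N.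
rewrite -(sum_item_prob (round_robin R) h u_inst) (bigD1 i) //= big1 ?addr0 //.
by move=> k k_neq; apply: off; rewrite -i_eq.
Qed.

Definition swap_bids (R : realType) : 'M[R]_(2, 2) :=
  \matrix_(i < 2, h < 2) (if i == h then 2 else 1).

Lemma is_instance_swap_bids (R : realType) : is_instance (swap_bids R).
Proof.
by split=> [i h|h]; [|exists h]; rewrite mxE; [case: ifP|rewrite eqxx].
Qed.

Theorem theorem9 (R : realType) :
  ~ exists M : mechanism R, envy_free_ex_ante M /\ pareto_efficient_ex_ante M.
Proof.
move=> [M [M_ef M_pe]].
have u_inst := is_instance_swap_bids R; set u := swap_bids R in u_inst.
(* Envy-freeness is quantified over all instances, so it also applies to the first item alone. *)
have EF1 := M_ef _ _ _ (is_instance_init u_inst).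
have EF2 := M_ef _ _ _ u_inst.
have sum0 := sum_item_prob M ord0 u_inst.
have sum1 := sum_item_prob M ord_max u_inst.
have w0 : widen_ord (leqnSn 1) ord0 = ord0 :> 'I_2 by apply: val_inj.
have l0 : lift ord0 ord0 = ord_max :> 'I_2 by apply: val_inj.
have exp_utilE (N : mechanism R) (i k : 'I_2) : exp_util N u i k =
    item_prob N u k ord0 * u i ord0 + item_prob N u k ord_max * u i ord_max.
  by rewrite /exp_util big_ord_recl big_ord1 l0.
have exp_util1E (i k : 'I_2) :
    exp_util M (init_bids u) i k = item_prob M u k ord0 * u i ord0.
  by rewrite /exp_util big_ord1 -item_prob_init // mxE !w0.
have u00 : u ord0 ord0 = 2 by rewrite mxE.
have u01 : u ord0 ord_max = 1 by rewrite mxE.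
have u10 : u ord_max ord0 = 1 by rewrite mxE.
have u11 : u ord_max ord_max = 2 by rewrite mxE.
have ord2P (i : 'I_2) : i = ord0 \/ i = ord_max.
  by case: i => [[|[|//]] lt_i]; [left | right]; apply: val_inj.
move: sum0 sum1; rewrite !big_ord_recl !big_ord0 !l0 => sum0 sum1.
move: (EF1 ord0 ord_max) (EF1 ord_max ord0); rewrite !exp_util1E u00 u10.
move: (EF2 ord0 ord_max) (EF2 ord_max ord0); rewrite !exp_utilE u00 u01 u10 u11.
move=> e1 e2 e3 e4.
(* [e3] and [e4] equate the shares of the first item, then [e1] and [e2] those of the second; by
   [sum0] and [sum1] all four are 1/2, and the claim is 3/2 < 2. *)
have improve (i : 'I_2) : exp_util M u i i < exp_util (round_robin R) u i i.
  rewrite !exp_utilE !item_prob_round_robin //.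
  by case: (ord2P i) => ->; rewrite ?u00 ?u01 ?u10 ?u11 /=; lra.
apply: (M_pe _ _ _ u_inst); exists (round_robin R); split=> [i|].
  exact/ltW/improve.
by exists ord0; apply: improve.
Qed.
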